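(* Let $G$ be an interval graph. If $G$ has two adjacent vertices $u$ and $v$, each of degree at least two, such that the edge $uv$ is not contained in any triangle of $G$, then there is no doubly partial order $D$ whose phylogeny graph $P(D)$ equals $G$.
   Context: All graphs and digraphs are finite and simple. For $x\in\mathbb{R}^2$ write $x=(x_1,x_2)$, and for $x,y\in\mathbb{R}^2$ write $x\prec y$ if $x_1<y_1$ and $x_2<y_2$. A digraph $D$ is a doubly partial order if there is a finite set $V\subseteq\mathbb{R}^2$ with $V(D)=V$ and $A(D)=\{(x,v)\mid v,x\in V,\ v\prec x\}$. For a vertex $x$, $N^+_D(x)=\{v\in V(D)\mid (x,v)\in A(D)\}$. The phylogeny graph $P(D)$ is the simple undirected graph with $V(P(D))=V(D)$ and $E(P(D))=\{xy\mid x\neq y,\ N^+_D(x)\cap N^+_D(y)\neq\emptyset\}\cup\{xy\mid (x,y)\in A(D)\}$. A graph $G$ is an interval graph if there is an assignment of real closed intervals $J(v)$ to the vertices $v$ such that for distinct $v,w$, $vw\in E(G)$ iff $J(v)\cap J(w)\neq\emptyset$. *)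

(* Defs.v *)
From mathcomp Require Import all_boot all_order all_algebra.
From mathcomp Require Import finmap reals.

Set Implicit Arguments.
Unset Strict Implicit.
Unset Printing Implicit Defensive.

Import Order.TTheory GRing.Theory Num.Theory.
Local Open Scope ring_scope.

Record digraph := Digraph {
  dvert :> finType;
  arc : rel dvert;
  arc_irr : irreflexive arc
}.

Record sgraph := SGraph {
  svert :> finType;
  adj : rel svert;
  adj_sym : symmetric adj;
  adj_irr : irreflexive adj
}.

Definition degree (G : sgraph) (x : G) : nat := #|[set y | adj x y]|.

Definition graph_iso (G H : sgraph) : Prop :=
  exists2 f : G -> H, bijective f & forall x y : G, adj (f x) (f y) = adj x y.

Definition prec (R : realType) (x y : R * R) : bool :=
  (x.1 < y.1) && (x.2 < y.2).

Lemma prec_irr (R : realType) : irreflexive (@prec R).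
Proof. by move=> x; rewrite /prec ltxx. Qed.

Section DoublyPartialOrder.
Variables (R : realType) (V : {fset (R * R)%type}).

(* Arcs go from the larger point to the smaller one. *)
Definition dpo_arc : rel V := fun x v => prec (val v) (val x).

Lemma dpo_arc_irr : irreflexive dpo_arc.
Proof. by move=> x; apply: prec_irr. Qed.

Definition dpo : digraph := Digraph dpo_arc_irr.

End DoublyPartialOrder.

Definition doubly_partial_order (R : realType) (D : digraph) : Prop :=
  exists V : {fset (R * R)%type}, D = dpo V.

Section Phylogeny.
Variable D : digraph.

Definition out_nbhd (x : D) : {set D} := [set v | arc x v].

Definition phylo_adj : rel D := fun x y =>
  [|| (x != y) && (out_nbhd x :&: out_nbhd y != set0), arc x y | arc y x].

Lemma phylo_adj_sym : symmetric phylo_adj.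
Proof.
by move=> x y; rewrite /phylo_adj eq_sym setIC [arc x y || _]orbC.
Qed.

Lemma phylo_adj_irr : irreflexive phylo_adj.
Proof. by move=> x; rewrite /phylo_adj eqxx arc_irr. Qed.

Definition phylogeny_graph : sgraph := SGraph phylo_adj_sym phylo_adj_irr.

End Phylogeny.

Definition interval_graph (R : realType) (G : sgraph) : Prop :=
  exists l r : G -> R,
    (forall v, l v <= r v) /\
    (forall v w, v != w ->
       (adj v w <-> exists x, x \in `[l v, r v] /\ x \in `[l w, r w])).

(* Main.v *)
Require Import Defs.
From mathcomp Require Import all_boot all_order all_algebra.
From mathcomp Require Import finmap reals.
(* [path.arc] would otherwise shadow the arc relation of digraphs. *)
Import Defs.

Set Implicit Arguments.
Unset Strict Implicit.
Unset Printing Implicit Defensive.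

(** The arc relation of a doubly partial order is transitive.  In the phylogeny
    graph of a transitive digraph, an edge contained in no triangle must be an
    arc [u -> v], since a common out-neighbour would complete a triangle.  Any
    other neighbour [w] of [v] then yields a triangle: on [w] itself if it is an
    in- or out-neighbour of [v], and otherwise on a common out-neighbour of [v]
    and [w].  Hence [v] has degree one. *)

Lemma dpo_arc_trans (R : realType) (V : {fset (R * R)%type}) :
  transitive (@dpo_arc R V).
Proof.
move=> y x z /andP[yx1 yx2] /andP[zy1 zy2].
by rewrite /dpo_arc /prec (Order.POrderTheory.lt_trans zy1 yx1)
           (Order.POrderTheory.lt_trans zy2 yx2).
Qed.

Lemma degree_ge2_neighbour (G : sgraph) (x y : G) :
  (2 <= degree x)%N -> exists2 w, adj x w & w != y.
Proof.
rewrite /degree (cardsD1 y) => dx.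
have /card_gt0P[w] : (0 < #|[set w | adj x w] :\ y|)%N.
  by case: (y \in _) dx => //= /ltnW.
by rewrite !inE => /andP[wy xw]; exists w.
Qed.

Section TransitiveDigraph.
Variable D : digraph.
Hypothesis arc_trans : transitive (@arc D).

Lemma phylo_adj_arc (x y : D) : arc x y -> phylo_adj x y.
Proof. by move=> xy; rewrite /phylo_adj xy orbT. Qed.

Lemma phylo_adj_common (x y z : D) :
  x != y -> arc x z -> arc y z -> phylo_adj x y.
Proof.
move=> neq xz yz; apply/or3P/Or31; rewrite neq.
by apply/set0Pn; exists z; rewrite !inE xz.
Qed.

Lemma phylo_adjP (x y : D) : phylo_adj x y ->
  [\/ exists2 z, arc x z & arc y z, arc x y | arc y x].
Proof.
case/or3P=> [/andP[_ /set0Pn[z]]|xy|yx]; [|exact: Or32|exact: Or33].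
by rewrite !inE => /andP[xz yz]; apply: Or31; exists z.
Qed.

Lemma arc_head_triangle (u v w : D) : arc u v -> phylo_adj v w -> w != u ->
  exists2 z, phylo_adj u z & phylo_adj v z.
Proof.
move=> uv vw wu; case: (phylo_adjP vw) => [[z vz _]|vw'|wv].
- by exists z; apply: phylo_adj_arc => //; apply: arc_trans vz.
- by exists w => //; apply: phylo_adj_arc; apply: arc_trans vw'.
- by exists w => //; apply: phylo_adj_common uv wv; rewrite eq_sym.
Qed.

Lemma phylogeny_edge_triangle (u v : phylogeny_graph D) :
  adj u v -> (2 <= degree u)%N -> (2 <= degree v)%N ->
  exists2 w, adj u w & adj v w.
Proof.
move=> uv du dv; case: (phylo_adjP uv) => [[z uz vz]|uv'|vu].
- by exists z; apply: phylo_adj_arc.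
- have [w vw wu] := degree_ge2_neighbour u dv.
  exact: arc_head_triangle uv' vw wu.
- have [w uw wv] := degree_ge2_neighbour v du.
  by have [z vz uz] := arc_head_triangle vu uw wv; exists z.
Qed.

End TransitiveDigraph.

Lemma degree_iso (G H : sgraph) (f : G -> H) (x : G) :
  bijective f -> (forall y z, adj (f y) (f z) = adj y z) ->
  degree (f x) = degree x.
Proof.
move=> f_bij f_adj; rewrite /degree -(card_imset _ (bij_inj f_bij)).
congr #|pred_of_set _|; case: f_bij => g fK gK; apply/setP => y.
by rewrite (can2_imset_pre _ fK gK) !inE -[in LHS](gK y) f_adj.
Qed.

Theorem theorem2p2 (R : realType) (G : sgraph) (u v : G) :
  interval_graph R G ->
  adj u v ->
  (2 <= degree u)%N ->
  (2 <= degree v)%N ->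
  ~ (exists w : G, adj u w /\ adj v w) ->
  ~ (exists D : digraph,
       doubly_partial_order R D /\ graph_iso (phylogeny_graph D) G).
Proof.
move=> _ uv du dv no_triangle [_ [[V ->] [f f_bij f_adj]]].
have [g _ gK] := f_bij; apply: no_triangle.
rewrite -(gK u) -(gK v) f_adj in uv *.
rewrite -(gK u) (degree_iso _ f_bij f_adj) in du.
rewrite -(gK v) (degree_iso _ f_bij f_adj) in dv.
have [w uw vw] :=
  @phylogeny_edge_triangle (dpo V) (@dpo_arc_trans R V) _ _ uv du dv.
by exists (f w); rewrite !f_adj.
Qed.
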